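(* Let $\mathcal{I}$ be a proper admissible ideal on $\mathbb{N}$. The space $2^{\mathfrak{b}(\mathcal{I})}$ contains a countable dense subspace which is not $\mathcal{I}$-H-separable.
   Context: An ideal on $\mathbb{N}$ is a family of subsets of $\mathbb{N}$ closed under finite unions and under subsets; it is admissible if it contains every singleton and proper if it does not contain $\mathbb{N}$. $2^\kappa$ is the Cantor cube, i.e. the product of $\kappa$ copies of the discrete space $2=\{0,1\}$. A space $X$ is $\mathcal{I}$-H-separable if for every sequence $(Y_n)_{n\in\mathbb{N}}$ of dense subspaces of $X$ there is a sequence $(F_n)_{n\in\mathbb{N}}$ such that each $F_n$ is a finite subset of $Y_n$ and for every nonempty open set $U$ of $X$, $\{n\in\mathbb{N} : U\cap F_n=\emptyset\}\in\mathcal{I}$. A set $S\subseteq\mathbb{N}^{\mathbb{N}}$ is $\mathcal{I}$-bounded if there is $g\in\mathbb{N}^{\mathbb{N}}$ such that $\{n\in\mathbb{N}: f(n)>g(n)\}\in\mathcal{I}$ for all $f\in S$, and $\mathcal{I}$-unbounded otherwise; $\mathfrak{b}(\mathcal{I})$ is the least cardinality of an $\mathcal{I}$-unbounded subset of $\mathbb{N}^{\mathbb{N}}$. *)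

(* Defs.v *)
From mathcomp Require Import all_boot all_classical topology.

Set Implicit Arguments.
Unset Strict Implicit.
Unset Printing Implicit Defensive.

Local Open Scope classical_set_scope.
Local Open Scope card_scope.

(* [I set0] is the empty case of closure under finite unions. *)
Definition is_ideal (I : set (set nat)) : Prop :=
  [/\ I set0,
      forall A B, I A -> I B -> I (A `|` B) &
      forall A B, A `<=` B -> I B -> I A].

Definition admissible_ideal (I : set (set nat)) : Prop :=
  forall n : nat, I [set n].

Definition proper_ideal (I : set (set nat)) : Prop := ~ I [set: nat].

Definition I_H_separable (I : set (set nat)) (X : topologicalType) : Prop :=
  forall Y : nat -> set X, (forall n, dense (Y n)) ->
  exists F : nat -> set X,
    (forall n, finite_set (F n) /\ F n `<=` Y n) /\
    forall U : set X, open U -> U !=set0 ->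
      I [set n | U `&` F n = set0].

Definition I_bounded (I : set (set nat)) (S : set (nat -> nat)) : Prop :=
  exists g : nat -> nat, forall f, S f -> I [set n | (g n < f n)%N].

Definition I_unbounded (I : set (set nat)) (S : set (nat -> nat)) : Prop :=
  ~ I_bounded I S.

(* b(I) is handled through the types K of that cardinality; [has_card_b_exists]
   below shows that there are such types when I is proper. *)
Definition has_card_b (I : set (set nat)) (K : Type) : Prop :=
  exists S : set (nat -> nat),
    [/\ I_unbounded I S,
        forall S', I_unbounded I S' -> S #<= S' &
        [set: K] #= S].

Lemma I_unbounded_setT (I : set (set nat)) :
  proper_ideal I -> I_unbounded I [set: nat -> nat].
Proof.
move=> pI [g gP]; apply: pI.
have := gP (fun n => (g n).+1) Logic.I.
by congr I; apply/seteqP; split => n //= _.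
Qed.

Lemma has_card_b_exists (I : set (set nat)) :
  proper_ideal I -> exists K : Type, has_card_b I K.
Proof.
move=> pI; set N := nat -> nat.
(* a maximal family of choice functions with injective evaluations *)
pose P : set (set (set N -> N)) := [set G | forall S, I_unbounded I S ->
  (forall g, G g -> S (g S)) /\
  (forall g h, G g -> G h -> g S = h S -> g = h)].
have [F FP totF|G [PG maxG]] := @Zorn_bigcup _ P.
  move=> S uS; split=> [g [A FA Ag]|g h [A FA Ag] [B FB Bh] gh].
    exact: (FP _ FA _ uS).1.
  have [AB|BA] := totF _ _ FA FB.
    by apply: (FP _ FB _ uS).2 gh => //; apply: AB.
  by apply: (FP _ FA _ uS).2 gh => //; apply: BA.
have [[S [uS SG]]|noS] := pselect (exists S, I_unbounded I S /\
    forall x, S x -> exists2 g, G g & g S = x).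
  exists S, S; split=> //.
  move=> S' uS'.
  have /choice[h hP] (x : N) : exists g, S x -> G g /\ g S = x.
    have [Sx|nSx] := pselect (S x); last by exists (fun=> x).
    by have [g Gg gS] := SG _ Sx; exists g.
  apply/pcard_leP/injfunPex; exists (fun x => h x S').
    by move=> x Sx; apply: (PG _ uS').1; apply: (hP x Sx).1.
  move=> x y /set_mem Sx /set_mem Sy hxy.
  have [Gx <-] := hP x Sx; have [Gy <-] := hP y Sy.
  by rewrite ((PG _ uS').2 _ _ Gx Gy hxy).
(* otherwise G misses a point of every unbounded set, so it can be enlarged *)
have /choice[h hP] (S : set N) : exists x, I_unbounded I S ->
    S x /\ forall g, G g -> g S <> x.
  have [uS|nuS] := pselect (I_unbounded I S); last by exists id.
  apply: contrapT => nx; apply: noS; exists S; split=> // x Sx.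
  apply: contrapT => ng; apply: nx; exists x => _; split=> // g Gg gS.
  by apply: ng; exists g.
have uT := I_unbounded_setT pI.
exfalso; apply: (maxG (G `|` [set h])).
  split=> [|sub]; first exact: subsetUl.
  by have Gh := sub h (or_intror erefl); apply: (hP _ uT).2 Gh erefl.
move=> S uS; have [Sh Nh] := hP S uS; have [GS Ginj] := PG S uS.
split=> [g [/GS//|->//]|f g [Gf|->] [Gg|->] fg //].
- exact: Ginj fg.
- by case: (Nh f Gf).
- by case: (Nh g Gg).
Qed.

(* Main.v *)
Require Import Defs.
From mathcomp Require Import all_boot all_classical topology.

(** Index the coordinates of the cube by an injective family [f] of functions
    [nat -> nat] whose range is [I]-unbounded.  As in the proof of the
    Hewitt-Marczewski-Pondiczery theorem, finite sets of finite sequences give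
    countably many points of the cube, sending [a] to whether the prefix of
    length [k] of [f a] lies in a given list [L]: finitely many distinct
    functions have distinct prefixes as soon as [k] is large, so such points
    realise every finite pattern.

    The failure of [I]-H-separability comes from switching off, in the [n]-th
    dense set, the coordinates [a] with [f a n > k] (see [prefix_point]).  A
    finite pattern is still realised because [k] may be taken large
    ([dense_prefix_points]), but now finitely many points of the [n]-th dense
    set use only values [k <= g n] for some [g n], and all of them vanish at
    [a] when [g n < f a n].  By unboundedness, for some [a] this happens for an
    [I]-positive set of [n], and the open set of points with value [true] at
    [a] then misses the chosen finite sets for all these [n]. *)

Local Open Scope classical_set_scope.

Lemma finite_set_bounded (T : Type) (A : set T) (h : T -> nat) :
  finite_set A -> exists N, forall a, A a -> (h a <= N)%N.
Proof.
move=> /(finite_image h)/finite_seqP[s hA].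
exists (\max_(i <- s) i) => a Aa.
have has : h a \in s.
  by have : [set` s] (h a) by rewrite -hA; exists a.
exact: (leq_bigmax_seq (h a) (F := id)).
Qed.

(** The sets of points agreeing with [x] on a finite set generate a filter
    that converges to [x] in each coordinate, hence in the product topology. *)
Lemma open_prod_contains_cylinder (K : Type) (T : topologicalType)
    (O : set {ptws K -> T}) (x : {ptws K -> T}) :
  open O -> O x ->
  exists2 A : set K, finite_set A &
    forall y : {ptws K -> T}, (forall a, A a -> y a = x a) -> O y.
Proof.
move=> oO Ox.
pose cyl (A : set K) := [set y : {ptws K -> T} | forall a, A a -> y a = x a].
pose F := filter_from (@finite_set K) cyl.
have FF : Filter F.
  apply: filter_from_filter; first by exists set0; exact: finite_set0.
  move=> A B fA fB; exists (A `|` B); first by rewrite finite_setU.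
  by move=> y yAB; split=> a ?; apply: yAB; [left|right].
have : F --> x.
  apply/cvg_sup => a B [_ [[C oC <-] Cx] CB].
  exists [set a]; first exact: finite_set1.
  by move=> y ya; apply: CB; rewrite /preimage /= ya.
by move=> /(_ O (open_nbhs_nbhs (conj oO Ox)))[A fA AO]; exists A.
Qed.

Lemma open_coordinate (K : Type) (T : topologicalType) (a : K) (B : set T) :
  open B -> open [set x : {ptws K -> T} | B (x a)].
Proof.
move=> oB; rewrite openE => x Bx.
(* the neighbourhood filter of [x] converges to [x], hence in coordinate [a] *)
have /cvg_sup/(_ a) : nbhs x --> x by exact: cvg_id.
apply; exists [set y : {ptws K -> T} | B (y a)]; split => //.
by exists B.
Qed.

Lemma dense_preimage_set_val (X : topologicalType) (D A : set X) :
  A `<=` D -> dense A -> dense (set_val @^-1` A : set (set_type D)).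
Proof.
move=> AD dA U [x Ux] [O oO OU].
have Ox : O (set_val x) by move: Ux; rewrite -OU.
rewrite -OU.
have [y [Oy Ay]] := dA O (ex_intro _ _ Ox) oO.
by exists (SigSub (mem_set (AD _ Ay))).
Qed.

(** Without the first conjunct these are the usual points of a countable dense
    subset of a cube of weight at most the continuum; the first conjunct makes
    a bound on [k] visible as zeros on the coordinates [a] with [f a n] large. *)
Definition prefix_point (K : Type) (f : K -> nat -> nat) (n : nat)
    (c : nat * seq (seq nat)) : {ptws K -> bool} :=
  fun a => (f a n <= c.1)%N && (mkseq (f a) c.1 \in c.2).

Definition prefix_points (K : Type) (f : K -> nat -> nat) (n : nat) :
    set {ptws K -> bool} := range (prefix_point K f n).

Lemma finite_separating_length (K : Type) (f : K -> nat -> nat) (A : set K) :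
  injective f -> finite_set A ->
  exists N, forall k, (N <= k)%N -> {in A &, injective (fun a => mkseq (f a) k)}.
Proof.
move=> finj fA.
have /choice[d dP] (p : K * K) :
    exists i, f p.1 i = f p.2 i -> p.1 = p.2.
  have [/funext/finj ->|/existsNP[i fi]] :=
    pselect (forall i, f p.1 i = f p.2 i); first by exists 0%N.
  by exists i => /fi.
have [N dN] := finite_set_bounded _ _ d (finite_setX fA fA).
exists N.+1 => k Nk a b /set_mem Aa /set_mem Ab fab; apply: (dP (a, b)).
have dk : (d (a, b) < k)%N by apply: leq_ltn_trans Nk; exact: dN.
by have := congr1 (nth 0%N ^~ (d (a, b))) fab; rewrite !nth_mkseq.
Qed.

Lemma dense_prefix_points (K : Type) (f : K -> nat -> nat) (n : nat) :
  injective f -> dense (prefix_points K f n).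
Proof.
move=> finj O [x Ox] oO.
have [A fA AO] := open_prod_contains_cylinder _ _ _ _ oO Ox.
have [N fN] := finite_set_bounded _ _ (fun a => f a n) fA.
have [M sepM] := finite_separating_length _ f _ finj fA.
pose k := maxn N M.
have [L LE] : exists L : seq (seq nat),
    (fun a => mkseq (f a) k) @` (A `&` [set a | x a]) = [set` L].
  by apply/finite_seqP/finite_image; exact: finite_setIl.
exists (prefix_point K f n (k, L)); split; last by exists (k, L).
apply: AO => a Aa; rewrite /prefix_point /=.
rewrite (leq_trans (fN a Aa)) ?leq_maxl //=.
apply/idP/idP => [|xa]; last first.
  by have : [set` L] (mkseq (f a) k) by rewrite -LE; exists a.
move=> aL; have : [set` L] (mkseq (f a) k) by [].
rewrite -LE => -[b [Ab xb]] /(sepM k (leq_maxr _ _)).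
by rewrite !inE => /(_ Ab Aa) <-.
Qed.

Lemma countable_prefix_points (K : Type) (f : K -> nat -> nat) :
  countable (\bigcup_n prefix_points K f n).
Proof.
apply: bigcup_countable => // n _.
exact: card_le_trans (card_image_le _ _) (countableP _).
Qed.

(** The bound on [k] over the finite selection from the [n]-th dense set is the
    function [g] to which unboundedness of the range of [f] is applied. *)
Lemma prefix_points_not_I_H_separable (I : set (set nat)) (K : Type)
    (f : K -> nat -> nat) :
  is_ideal I -> injective f -> I_unbounded I (range f) ->
  ~ I_H_separable I (set_type (\bigcup_n prefix_points K f n)).
Proof.
move=> [_ _ Isub] finj unb.
set D := \bigcup_n prefix_points K f n.
have sub n : prefix_points K f n `<=` D by move=> x; exists n.
pose Y n : set (set_type D) := set_val @^-1` prefix_points K f n.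
have dY n : dense (Y n).
  by apply: dense_preimage_set_val; [exact: sub|exact: dense_prefix_points].
move=> /(_ Y dY)[F [FY FI]].
have /choice[g gP] (n : nat) : exists N, forall x, F n x ->
    exists2 c, (c.1 <= N)%N & prefix_point K f n c = set_val x.
  have [finF subF] := FY n.
  have /choice[c cP] (x : set_type D) : exists c,
      F n x -> prefix_point K f n c = set_val x.
    have [/subF[c _ cx]|nFx] := pselect (F n x); first by exists c.
    by exists (0%N, [::]).
  have [N cN] := finite_set_bounded _ _ (fun x => (c x).1) finF.
  by exists N => x Fx; exists (c x); [exact: cN|exact: cP].
apply: unb; exists g => _ [a _ <-].
pose O := [set x : {ptws K -> bool} | [set true] (x a)].
have oO : open O by apply: open_coordinate; exact: discrete_open.
pose U : set (set_type D) := set_val @^-1` O.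
have oU : open U by exists O.
have U0 : U !=set0.
  have [x [Ox Px]] : O `&` prefix_points K f 0 !=set0.
    by apply: dense_prefix_points => //; exists (fun=> true).
  by exists (SigSub (mem_set (sub _ _ Px))).
apply: Isub (FI U oU U0) => n /= gfn.
rewrite -subset0 => x [Ux /gP[c cg cx]]; move: Ux.
rewrite /U /O /preimage /= -cx /prefix_point leqNgt.
by rewrite (leq_ltn_trans cg gfn).
Qed.

Theorem theorem3p20 (I : set (set nat)) (K : Type) :
  is_ideal I -> admissible_ideal I -> proper_ideal I -> has_card_b I K ->
  exists D : set {ptws K -> bool},
    [/\ countable D, dense D & ~ I_H_separable I (set_type D)].
Proof.
move=> idI _ _ [S [unb _ /card_set_bijP[f [fS /in2TT finj Sf]]]].
have rangeE : range f = S.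
  by apply/seteqP; split=> // _ [a _ <-]; exact: fS.
exists (\bigcup_n prefix_points K f n); split.
- exact: countable_prefix_points.
- move=> O O0 oO; have [x [Ox Px]] := dense_prefix_points K f 0 finj O O0 oO.
  by exists x; split=> //; exists 0%N.
- by apply: prefix_points_not_I_H_separable => //; rewrite rangeE.
Qed.
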